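(* GMSNP and MMSNP$_2$ have the same expressive power. That is, for every schema $\mathbf{S}$ and every GMSNP formula over $\mathbf{S}$ there is an MMSNP$_2$ formula over $\mathbf{S}$ with the same free variables that is satisfied in exactly the same $\mathbf{S}$-instances under the same assignments of active-domain elements to the free variables, and vice versa.
   Context: A schema $\mathbf{S}$ is a finite set of relation symbols with arities. An instance $\mathfrak{D}$ over $\mathbf{S}$ is a finite set of facts $R(a_1,\dots,a_n)$, $R\in\mathbf{S}$, over constants; $\mathrm{adom}(\mathfrak{D})$ is the set of constants occurring in $\mathfrak{D}$. Formulas are evaluated in the structure $(\mathrm{adom}(\mathfrak{D}),\mathfrak{D})$ with domain $\mathrm{adom}(\mathfrak{D})$; sentences are taken to be true in the empty instance. A GMSNP formula over $\mathbf{S}$ has the form $\exists X_1\cdots\exists X_n\forall x_1\cdots\forall x_m\,\varphi$ with $X_1,\dots,X_n$ second-order variables of any arity, $x_1,\dots,x_m$ first-order variables, and $\varphi$ a conjunction of formulas $\alpha_1\wedge\cdots\wedge\alpha_k\to\beta_1\vee\cdots\vee\beta_l$ with $k,l\ge 0$, where each $\alpha_i$ is of the form $X_j(\mathbf{x})$, $R(\mathbf{x})$ with $R\in\mathbf{S}$, or $x=y$, and each $\beta_i$ is of the form $X_j(\mathbf{x})$; additionally, for every head atom $\beta_i$ there must be a body atom $\alpha_j$ containing all variables of $\beta_i$. An MMSNP formula is defined in the same way except that all second-order variables are monadic and the additional requirement on head atoms is dropped. Free first-order variables are admitted. MMSNP$_2$ is the extension of MMSNP in which the monadic second-order variables range over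 sets of domain elements and facts, and in which atoms of the form $X(R(\mathbf{x}))$, with $X$ a second-order variable and $R\in\mathbf{S}$, are allowed in place of atoms $X(x)$; it is required that whenever an atom $X(R(\mathbf{x}))$ occurs in the head of an implication, the atom $R(\mathbf{x})$ occurs in the body of that implication. Formally, an assignment $\pi$ interprets each second-order variable as a set $\pi(X)\subseteq\mathrm{adom}(\mathfrak{D})\cup\mathfrak{D}$, and $X(R(x_1,\dots,x_n))$ is satisfied in $\mathfrak{D}$ under $\pi$ if $R(\pi(x_1),\dots,\pi(x_n))\in\pi(X)$. *)

(* Defs.v *)
From mathcomp Require Import all_boot finmap.

Set Implicit Arguments.
Unset Strict Implicit.
Unset Printing Implicit Defensive.

Local Open Scope fset_scope.

Record schema := Schema { symbol :> finType; arity : symbol -> nat }.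

(* The expressions R(t_1, ..., t_n) with R in S and n the arity of R. With    *)
(* constants for T these are the facts over S; with first-order variables for *)
(* T they are the relational atoms over S.                                    *)
Definition fact (S : schema) (T : Type) := {R : S & (arity R).-tuple T}.

Definition fact_map (S : schema) (T U : Type) (h : T -> U) (A : fact S T) :
    fact S U :=
  Tagged (fun R : S => (arity R).-tuple U) (map_tuple h (tagged A)).

Definition instance (S : schema) (C : choiceType) := {fset fact S C}.

Definition adom (S : schema) (C : choiceType) (D : instance S C) : {fset C} :=
  \bigcup_(A <- D) [fset c in tval (tagged A)].

(* V is the set of first-order variables, and A the set of second-order atoms *)
(* (those allowed both in bodies and in heads), in which GMSNP and MMSNP_2    *)
(* differ.                                                                    *)
Inductive atom (S : schema) (V A : Type) :=
  | SecondOrder of A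
  | Relational of fact S V
  | Equal of V & V.

Record clause (S : schema) (V A : Type) :=
  Clause { body : seq (atom S V A); head : seq A }.

(* Truth of a clause in the structure (adom D, D) under v, given the truth    *)
(* value sat_so of each second-order atom.                                    *)
Definition atom_sat (S : schema) (V A : Type) (C : choiceType)
    (D : instance S C) (sat_so : pred A) (v : V -> adom D)
    (t : atom S V A) : bool :=
  match t with
  | SecondOrder t' => sat_so t'
  | Relational B => fact_map (fun x => val (v x)) B \in D
  | Equal x y => v x == v y
  end.

Definition clause_sat (S : schema) (V A : Type) (C : choiceType)
    (D : instance S C) (sat_so : pred A) (v : V -> adom D)
    (c : clause S V A) : bool :=
  all (atom_sat sat_so v) (body c) ==> has sat_so (head c).

Definition assign (F B T : Type) (a : F -> T) (b : B -> T) (x : F + B) : T :=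
  match x with inl y => a y | inr y => b y end.

Definition gso_atom (X : Type) (ar : X -> nat) (V : Type) :=
  {Z : X & (ar Z).-tuple V}.

Definition atom_vars (S : schema) (X : Type) (ar : X -> nat) (V : Type)
    (t : atom S V (gso_atom ar V)) : seq V :=
  match t with
  | SecondOrder t' => tagged t'
  | Relational B => tagged B
  | Equal x y => [:: x; y]
  end.

Definition guarded (S : schema) (X : Type) (ar : X -> nat) (V : eqType)
    (c : clause S V (gso_atom ar V)) : bool :=
  all (fun h : gso_atom ar V =>
         has (fun t => all (mem (atom_vars t)) (tagged h)) (body c))
      (head c).

(* GMSNP formulas over S whose free first-order variables are those of the    *)
(* finite set F; the universally quantified first-order variables and the     *)
(* second-order variables are given as finite index sets. A first-order       *)
(* variable is free (inl) or universally quantified (inr).                    *)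
Record gmsnp (S : schema) (F : finType) := Gmsnp {
  g_so : finType;
  g_so_arity : g_so -> nat;
  g_fo : finType;
  g_clauses : seq (clause S (F + g_fo)%type
                     (gso_atom g_so_arity (F + g_fo)%type));
  g_guarded : all (@guarded S g_so g_so_arity (F + g_fo)%type) g_clauses
}.

Definition gso_sat (X : Type) (ar : X -> nat) (V : Type) (T : finType)
    (I : forall Z : X, {set (ar Z).-tuple T}) (v : V -> T)
    (t : gso_atom ar V) : bool :=
  map_tuple v (tagged t) \in I (tag t).

(* The first disjunct is the convention that sentences are true in the empty  *)
(* instance; when F is inhabited there is no assignment a into adom fset0.    *)
Definition gmsnp_sat (S : schema) (F : finType) (phi : gmsnp S F)
    (C : choiceType) (D : instance S C) (a : F -> adom D) : Prop :=
  D = fset0 \/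
  exists I : forall Z : g_so phi, {set (g_so_arity Z).-tuple (adom D)},
    forall b : g_fo phi -> adom D,
      all (clause_sat (gso_sat I (assign a b)) (assign a b)) (g_clauses phi).

Inductive mso_atom (S : schema) (X V : Type) :=
  | OnElement of X & V
  | OnFact of X & fact S V.

(* Only head atoms X(R(x)) are constrained; head atoms X(x) need no guard.    *)
Definition fact_guarded (S : schema) (X : Type) (V : choiceType)
    (c : clause S V (mso_atom S X V)) : bool :=
  all (fun h => match h with
         | OnElement _ _ => true
         | OnFact _ A =>
             has (fun t => if t is Relational B then B == A else false) (body c)
         end)
      (head c).

Record mmsnp2 (S : schema) (F : finType) := Mmsnp2 {
  m_so : finType;
  m_fo : finType;
  m_clauses : seq (clause S (F + m_fo)%type (mso_atom S m_so (F + m_fo)%type));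
  m_guarded : all (@fact_guarded S m_so (F + m_fo)%type) m_clauses
}.

(* A second-order variable denotes a subset of adom(D) + D. An atom X(R(x))   *)
(* is false when the image of R(x) is not a fact of D.                        *)
Definition mso_sat (S : schema) (X V : Type) (C : choiceType)
    (D : instance S C) (I : X -> {set (adom D + D)%type}) (v : V -> adom D)
    (t : mso_atom S X V) : bool :=
  match t with
  | OnElement Z x => inl (v x) \in I Z
  | OnFact Z A =>
      [exists B : D, (val B == fact_map (fun x => val (v x)) A)
                     && (inr B \in I Z)]
  end.

Definition mmsnp2_sat (S : schema) (F : finType) (psi : mmsnp2 S F)
    (C : choiceType) (D : instance S C) (a : F -> adom D) : Prop :=
  D = fset0 \/
  exists I : m_so psi -> {set (adom D + D)%type},
    forall b : m_fo psi -> adom D,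
      all (clause_sat (mso_sat I (assign a b)) (assign a b)) (m_clauses psi).

(* Main.v *)
(* From MMSNP_2 to GMSNP, a set variable X is split into a unary relation and *)
(* one relation of arity ar(R) per symbol R; the guard R(x) of X(R(x)) is     *)
(* precisely the guard that GMSNP asks for.                                   *)
(*   From GMSNP to MMSNP_2, guardedness allows one to discard from the        *)
(* second-order relations all tuples whose entries do not occur together in a *)
(* single fact. The tuple (c_(f 1), ..., c_(f n)) of Z is then coded by       *)
(* putting the fact R(c_1, ..., c_r) in a set indexed by (Z, R, f). A clause  *)
(* is replaced by all the clauses obtained by choosing, for each of its       *)
(* second-order atoms, some triples (Z, R, f), with the R-fact on fresh       *)
(* variables. A tuple may be coded by several facts and satisfies Z as soon   *)
(* as one of the codes is present, so no consistency between codes is needed. *)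

Require Import Defs.
From mathcomp Require Import all_boot finmap.

Set Implicit Arguments.
Unset Strict Implicit.
Unset Printing Implicit Defensive.

(** Both translations are verified by transporting interpretations. From MMSNP$_2$, [gso_interpP]
    and [mso_interpP] show that atoms keep their truth value, up to the condition that a coded fact
    lies in [D]; the added body atoms and the head guards supply that condition. From GMSNP,
    [guard_clause_sound] marks the facts that code tuples of the given relations. Conversely,
    [coded_interp] decodes the marks into relations. By [body_covered], every true body atom,
    whatever its kind, has its values inside one fact of [D], so every guarded head tuple has a
    place for a code; [guard_clause_complete] evaluates the fresh variables at such facts. *)

Lemma all_flatten_map (T U : Type) (p : pred U) (f : T -> seq U) (s : seq T) :
  all p (flatten (map f s)) = all (fun x => all p (f x)) s.
Proof. by elim: s => //= x s IHs; rewrite all_cat IHs. Qed.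

Lemma clause_sat_impl (S : schema) (V A : Type) (C : choiceType)
    (D : instance S C) (so : pred A) (v : V -> adom D) (c : clause S V A) :
  clause_sat so v c <-> (all (atom_sat so v) (body c) -> has so (Defs.head c)).
Proof. by split=> /implyP. Qed.

Lemma map_val_inj (C : choiceType) (E : {fset C}) n :
  injective (@map_tuple n E C val).
Proof.
move=> t u /(congr1 val) /(inj_map val_inj) tu; exact: val_inj.
Qed.

Lemma lift_tuple (C : choiceType) (E : {fset C}) n (t : n.-tuple C) :
  {subset t <= E} -> exists u : n.-tuple E, map_tuple val u = t.
Proof.
move=> tE; have tEi i : tnth t i \in E by apply/tE/mem_tnth.
exists [tuple [` tEi i]%fset | i < n].
by apply: eq_from_tnth => i; rewrite tnth_map tnth_mktuple.
Qed.

Lemma fact_sub_adom (S : schema) (C : choiceType) (D : instance S C)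
    (B : fact S C) :
  B \in D -> {subset tagged B <= adom D}.
Proof. by move=> BD x xB; apply/bigfcupP; exists B; rewrite ?BD ?inE. Qed.

Lemma adom_in_fact (S : schema) (C : choiceType) (D : instance S C)
    (d : adom D) :
  exists2 B, B \in D & val d \in tagged B.
Proof.
by have /bigfcupP[B /andP[BD _]] := valP d; rewrite inE; exists B.
Qed.

(** * From MMSNP$_2$ to GMSNP: translation of clauses *)

Section FromMmsnp2.
Variables (S : schema) (X : finType).

Definition so_ar (Z : X * option S) : nat :=
  if Z.2 is Some R then arity R else 1.

Definition gso_of_mso (V : Type) (t : mso_atom S X V) : gso_atom so_ar V :=
  match t with
  | OnElement Z x => existT (fun Y => (so_ar Y).-tuple V) (Z, None) [tuple x]
  | OnFact Z A =>
      existT (fun Y => (so_ar Y).-tuple V) (Z, Some (tag A)) (tagged A)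
  end.

(* In GMSNP nothing forces the facts coded by a relation variable to be in   *)
(* the instance, so the body atom R(x) is added to X(R(x)).                  *)
Definition gso_body (V : Type) (t : atom S V (mso_atom S X V)) :
    seq (atom S V (gso_atom so_ar V)) :=
  match t with
  | SecondOrder t' =>
      SecondOrder S V (gso_of_mso t') ::
        (if t' is OnFact _ A then [:: Relational _ A] else [::])
  | Relational A => [:: Relational _ A]
  | Equal x y => [:: Equal S _ x y]
  end.

(** A head atom X(x) may be unguarded in MMSNP$_2$; the valid equality x = x serves as its guard in
    GMSNP. *)
Definition self_guard (V : Type) (t : mso_atom S X V) :
    seq (atom S V (gso_atom so_ar V)) :=
  if t is OnElement _ x then [:: Equal S _ x x] else [::].

Definition gclause (V : Type) (c : clause S V (mso_atom S X V)) :
    clause S V (gso_atom so_ar V) :=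
  Clause (flatten (map (@gso_body V) (body c)) ++
            flatten (map (@self_guard V) (Defs.head c)))
         (map (@gso_of_mso V) (Defs.head c)).

Lemma gclause_guarded (V : choiceType) (c : clause S V (mso_atom S X V)) :
  fact_guarded c -> guarded (gclause c).
Proof.
rewrite /fact_guarded /guarded /= all_map.
elim: (Defs.head c) (body c) => //= h hs IHs bs /andP[hP /IHs hsP].
apply/andP; split.
  case: h hP => [Z x _ | Z A] /=.
    by rewrite has_cat /= inE eqxx orbT.
  rewrite /= has_cat => AP; apply/orP; left.
  elim: bs AP {hsP} => //= t bs IHb /orP[|/IHb bsP].
    case: t => // B /eqP->; rewrite has_cat /=.
    by apply/orP; left; rewrite orbF; apply/allP.
  by rewrite has_cat bsP orbT.
apply: sub_all hsP => t; rewrite /= !has_cat => /orP[->//|tP].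
by rewrite tP !orbT.
Qed.

End FromMmsnp2.

(** * From MMSNP$_2$ to GMSNP: transport of interpretations *)

Section FromMmsnp2Sem.
Variables (S : schema) (X : finType) (C : choiceType) (D : instance S C).

Definition gso_interp (J : X -> {set (adom D + D)%type}) (Z : X * option S) :
    {set (so_ar Z).-tuple (adom D)} :=
  match Z with
  | (Z, None) => [set t : 1.-tuple (adom D) | inl (thead t) \in J Z]
  | (Z, Some R) =>
      [set t : (arity R).-tuple (adom D) |
        [exists B : D, (val B == existT _ R (map_tuple val t)) &&
                       (inr B \in J Z)]]
  end.

Definition mso_interp (I : forall Z : X * option S,
      {set (so_ar Z).-tuple (adom D)}) (Z : X) : {set (adom D + D)%type} :=
  [set z : (adom D + D)%type |
    match z with
    | inl d => [tuple d] \in I (Z, None)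
    | inr B => [exists t : (arity (tag (val B))).-tuple (adom D),
                  (map_tuple val t == tagged (val B)) &&
                  (t \in I (Z, Some (tag (val B))))]
    end].

Lemma gso_interpP V (J : X -> {set (adom D + D)%type}) (v : V -> adom D)
    (t : mso_atom S X V) :
  gso_sat (gso_interp J) v (gso_of_mso t) = mso_sat J v t.
Proof.
case: t => [Z x | Z [R x]]; rewrite /gso_sat /= inE //.
apply: eq_existsb => B; congr ((_ == _) && _).
by congr existT; apply: val_inj; rewrite /= -map_comp.
Qed.

(** A GMSNP relation may contain tuples that are not facts of [D], whereas a set variable cannot;
    hence the extra conjunct. *)
Lemma mso_interpP V (I : forall Z : X * option S,
      {set (so_ar Z).-tuple (adom D)}) (v : V -> adom D) (t : mso_atom S X V) :
  mso_sat (mso_interp I) v t =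
  gso_sat I v (gso_of_mso t) &&
    (if t is OnFact _ A then fact_map (fun x => val (v x)) A \in D else true).
Proof.
case: t => [Z x | Z [R x]] /=; rewrite /gso_sat /=.
  rewrite inE andbT.
  by have <- : map_tuple v [tuple x] = [tuple v x] by apply: val_inj.
have valv : map_tuple (fun y => val (v y)) x = map_tuple val (map_tuple v x).
  by apply: val_inj; rewrite /= -map_comp.
apply/existsP/andP => [[[B BD] /= /andP[/eqP BE]]|[xI xD]].
  rewrite -BE BD inE /=; subst B => /existsP[t /andP[/eqP]] /=.
  by rewrite valv => /map_val_inj->.
exists [` xD]%fset; rewrite eqxx inE /=; apply/existsP.
by exists (map_tuple v x); rewrite valv eqxx.
Qed.

End FromMmsnp2Sem.

Lemma mmsnp2_gmsnp (S : schema) (F : finType) (psi : mmsnp2 S F) :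
  exists phi : gmsnp S F,
    forall (C : choiceType) (D : instance S C) (a : F -> adom D),
      mmsnp2_sat psi a <-> gmsnp_sat phi a.
Proof.
have guard : all (@guarded S _ (@so_ar S (m_so psi)) (F + m_fo psi)%type)
    (map (@gclause S (m_so psi) (F + m_fo psi)%type) (m_clauses psi)).
  rewrite all_map; apply: sub_all (m_guarded psi) => c.
  exact: gclause_guarded.
exists (Gmsnp guard) => C D a.
split=> -[D0 | [I IP]]; [by left | right | by left | right].
  exists (gso_interp I) => b /=; rewrite all_map; apply: sub_all (IP b).
  move=> c /clause_sat_impl cP; apply/clause_sat_impl => /=.
  rewrite all_cat all_flatten_map => /andP[bP _].
  rewrite has_map (eq_has (a2 := mso_sat I (assign a b))); last first.
    exact: gso_interpP.
  apply: cP; apply: sub_all bP => -[t | A | x y] /=.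
  - by rewrite gso_interpP => /andP[].
  - by rewrite andbT.
  - by rewrite andbT.
exists (mso_interp I) => b; have := conj (m_guarded psi) (IP b).
rewrite /= all_map => /andP; rewrite -all_predI; apply: sub_all => c /andP[cg].
move=> /clause_sat_impl /= cP; apply/clause_sat_impl => bP.
rewrite all_cat !all_flatten_map has_map in cP.
have : has (fun t => gso_sat I (assign a b) (gso_of_mso t)) (Defs.head c).
  apply: cP; apply/andP; split.
    apply: sub_all bP => -[t | A | x y] /=; rewrite ?andbT //.
    by rewrite mso_interpP; case: t => [Z x | Z A] /= /andP[-> AD] //=; rewrite AD.
  by elim: (Defs.head c) => //= -[Z x | Z A] hs -> //=; rewrite eqxx.
(* The fact of a true head atom occurs in the body, so its image lies in [D], as [mso_interpP]
   requires. *)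
move: cg; rewrite /fact_guarded; elim: (Defs.head c) => //= h hs IHs.
case/andP=> hg hsg /orP[hP | /(IHs hsg) ->]; last by rewrite orbT.
rewrite mso_interpP hP /=; case: h hg hP => [//|Z A] Ag _.
apply/orP; left; elim: (body c) bP Ag => //= t ts IHt /andP[tP /IHt tsP].
by case/orP=> //; case: t tP => // B BD /eqP <-.
Qed.

Lemma fact_map_comp (S : schema) (T U W : Type) (f : U -> W) (g : T -> U)
    (A : fact S T) : fact_map f (fact_map g A) = fact_map (f \o g) A.
Proof. by congr existT; apply: val_inj; rewrite /= -map_comp. Qed.

(** * From GMSNP to MMSNP$_2$: coding tuples by facts *)

Section FromGmsnp.
Variables (S : schema) (X : finType) (ar : X -> nat) (F U : finType).

Local Notation V := (F + U)%type.

(* Without first-order variables only nullary facts can guard anything. The  *)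
(* restriction then keeps the type of fresh variables empty, so that the     *)
(* universal quantifiers do not become vacuous over an instance that has     *)
(* nullary facts only, whose active domain is empty.                         *)
Definition guard_symbol := {R : S | (0 < #|{: V}|) || (arity R == 0)}.

Definition guard_pos (Z : X) :=
  {R : guard_symbol & (ar Z).-tuple 'I_(arity (val R))}.

(* The set variable (Z, R, f) holds of the facts R(c_1, ..., c_r) such that  *)
(* Z(c_(f 1), ..., c_(f n)).                                                 *)
Definition guard_var := {Z : X & guard_pos Z}.

Definition guard_sym (p : guard_var) : S := val (tag (tagged p)).

Definition guarded_atom := {p : guard_var & (ar (tag p)).-tuple V}.

Definition unguard (q : guarded_atom) : gso_atom ar V :=
  existT (fun Z => (ar Z).-tuple V) (tag (tag q)) (tagged q).

(* The Boolean tells head atoms from body atoms: the guards chosen for the   *)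
(* two need not be the same.                                                 *)
Definition guard_choice := (bool * guarded_atom)%type.

Definition fresh := {e : guard_choice & 'I_(arity (guard_sym (tag e.2)))}.

Definition new_var (x : V) : F + (U + fresh) :=
  match x with inl y => inl y | inr y => inr (inl y) end.

Definition fresh_var (e : guard_choice) (i : 'I_(arity (guard_sym (tag e.2)))) :
    F + (U + fresh) :=
  inr (inr (existT _ e i)).

Definition guard_fact (e : guard_choice) : fact S (F + (U + fresh))%type :=
  existT _ (guard_sym (tag e.2)) [tuple fresh_var i | i < _].

Definition guard_atom (e : guard_choice) :
    mso_atom S guard_var (F + (U + fresh))%type :=
  OnFact (tag e.2) (guard_fact e).

Local Notation atom' :=
  (atom S (F + (U + fresh))%type
     (mso_atom S guard_var (F + (U + fresh))%type)).

Definition guard_body (e : guard_choice) : seq atom' :=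
  Relational _ (guard_fact e) ::
  [seq Equal S _ (new_var (tnth (tagged e.2) j))
         (fresh_var (tnth (tagged (tagged (tag e.2))) j))
  | j <- enum 'I_(ar (tag (tag e.2)))].

Definition plain_body (t : atom S V (gso_atom ar V)) : seq atom' :=
  match t with
  | SecondOrder _ => [::]
  | Relational A => [:: Relational _ (fact_map new_var A)]
  | Equal x y => [:: Equal S _ (new_var x) (new_var y)]
  end.

Definition so_atoms (c : clause S V (gso_atom ar V)) (in_head : bool) :
    seq (gso_atom ar V) :=
  if in_head then Defs.head c
  else pmap (fun t => if t is SecondOrder k then Some k else None) (body c).

(** Each second-order atom gets at least one guard, possibly several, so that a proof may take all
    suitable guards at once. *)
Definition choice_of (c : clause S V (gso_atom ar V)) (A : {set guard_choice}) :=
  [forall h : bool, [forall k : gso_atom ar V,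
     (k \in so_atoms c h) ==
       [exists q : guarded_atom, ((h, q) \in A) && (unguard q == k)]]].

Definition guard_clause (c : clause S V (gso_atom ar V))
    (A : {set guard_choice}) : clause S (F + (U + fresh))%type
      (mso_atom S guard_var (F + (U + fresh))%type) :=
  Clause (flatten (map plain_body (body c)) ++ flatten (map guard_body (enum A))
            ++ [seq SecondOrder S _ (guard_atom e) | e <- enum A & ~~ e.1])
         [seq guard_atom e | e <- enum A & e.1].

Definition guard_clauses (cs : seq (clause S V (gso_atom ar V))) :=
  flatten [seq [seq guard_clause c A
               | A <- enum {set guard_choice} & choice_of c A] | c <- cs].

Lemma guard_clauses_guarded (cs : seq (clause S V (gso_atom ar V))) :
  all (@fact_guarded S guard_var (F + (U + fresh))%type) (guard_clauses cs).
Proof.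
rewrite all_flatten_map; elim: cs => //= c cs ->; rewrite andbT.
rewrite all_map; apply: sub_all (all_predT _) => A _ /=.
rewrite /fact_guarded /= all_map; apply/allP => e.
rewrite mem_filter => /andP[_ eA] /=; rewrite !has_cat; apply/orP; right.
apply/orP; left; elim: (enum A) eA => //= e' es IHe.
rewrite inE => /orP[/eqP<- | /IHe esP]; first by rewrite eqxx.
by rewrite has_cat esP !orbT.
Qed.

(** * From relations to sets of facts *)

Variables (C : choiceType) (D : instance S C).

Definition fact_of (R : S) (w : (arity R).-tuple (adom D)) : fact S C :=
  existT _ R (map_tuple val w).

Definition matches (v : V -> adom D) (q : guarded_atom)
    (w : (arity (guard_sym (tag q))).-tuple (adom D)) :=
  (fact_of w \in D) &&
  (map_tuple v (tagged q) == map_tuple (tnth w) (tagged (tagged (tag q)))).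
Arguments matches v q w : clear implicits.

Definition fresh_tuple (v : F + (U + fresh) -> adom D) (e : guard_choice) :=
  [tuple v (fresh_var i) | i < arity (guard_sym (tag e.2))].

Lemma guard_factE (v : F + (U + fresh) -> adom D) (e : guard_choice) :
  fact_map (fun x => val (v x)) (guard_fact e) = fact_of (fresh_tuple v e).
Proof.
congr existT; apply: eq_from_tnth => i /=.
by rewrite !tnth_map tnth_ord_tuple.
Qed.

Section Extension.
Variables (v : V -> adom D) (v' : F + (U + fresh) -> adom D).
Hypothesis v'E : forall x, v' (new_var x) = v x.

Lemma guard_bodyP so (e : guard_choice) :
  all (atom_sat so v') (guard_body e) = matches v e.2 (fresh_tuple v' e).
Proof.
rewrite /= guard_factE /matches all_map; congr andb.
apply/allP/eqP => [eqv | eqv j _].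
  apply: eq_from_tnth => j; rewrite !tnth_map tnth_ord_tuple -v'E.
  by have /= /eqP -> := eqv j (mem_enum _ _).
have /= := congr1 (fun t => tnth t j) eqv.
by rewrite !tnth_map tnth_ord_tuple v'E => ->.
Qed.

Lemma plain_bodyP so so' (t : atom S V (gso_atom ar V)) :
  all (atom_sat so v') (plain_body t) =
  if t is SecondOrder _ then true else atom_sat so' v t.
Proof.
case: t => [k|[R x]|x y] //=; rewrite andbT ?v'E //.
suff -> : fact_map (fun y => val (v' y)) (fact_map new_var (existT _ R x)) =
          fact_map (fun y => val (v y)) (existT _ R x) by [].
rewrite fact_map_comp; congr existT; apply: val_inj => /=.
by apply: eq_map => y /=; rewrite v'E.
Qed.

Lemma all_body so (bs : seq (atom S V (gso_atom ar V))) :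
  all (atom_sat so v) bs =
  all (fun t => if t is SecondOrder _ then true else atom_sat so v t) bs &&
  all so (pmap (fun t => if t is SecondOrder k then Some k else None) bs).
Proof.
elim: bs => //= -[k|A|x y] bs -> /=; [exact: andbCA | exact: andbA | exact: andbA].
Qed.

Section Interp.
Variable I : forall Z : X, {set (ar Z).-tuple (adom D)}.

Definition guard_interp (p : guard_var) : {set (adom D + D)%type} :=
  [set z : (adom D + D)%type |
    if z is inr B then
      [exists w : (arity (guard_sym p)).-tuple (adom D),
         (val B == fact_of w) && (map_tuple (tnth w) (tagged (tagged p)) \in I (tag p))]
    else false].

Lemma fact_of_inj R : injective (@fact_of R).
Proof.
by move=> w w' /eqP; rewrite eq_Tagged => /eqP/map_val_inj.
Qed.

Lemma guard_interpP e :
  matches v e.2 (fresh_tuple v' e) ->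
  mso_sat guard_interp v' (guard_atom e) = gso_sat I v (unguard e.2).
Proof.
case/andP=> wD /eqP wE; rewrite /gso_sat /= wE.
apply/existsP/idP => [[[B BD] /=] | wI].
  rewrite guard_factE inE /= => /andP[/eqP-> /existsP[w /andP[/eqP]]].
  by move=> /fact_of_inj <-.
exists [` wD]%fset; rewrite guard_factE inE eqxx /=.
by apply/existsP; exists (fresh_tuple v' e); rewrite eqxx.
Qed.

(** The guards in the new body make all chosen facts match, and then [guard_interpP] identifies
    marks with the original atoms. Every atom of [c] has a chosen guard on its side, so truth passes
    from the new body to the old one and from the old head to the new one. *)
Lemma guard_clause_sound c A :
  choice_of c A -> clause_sat (gso_sat I v) v c ->
  clause_sat (mso_sat guard_interp v') v' (guard_clause c A).
Proof.
move=> /forallP cA /clause_sat_impl cP; apply/clause_sat_impl.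
rewrite /= !all_cat !all_flatten_map all_map => /and3P[plain /allP sides bodies].
have matchA e : e \in A -> matches v e.2 (fresh_tuple v' e).
  by rewrite -mem_enum => /sides; rewrite guard_bodyP.
have inA h k : k \in so_atoms c h -> exists2 q, (h, q) \in A & unguard q = k.
  have /forallP/(_ k)/eqP-> := cA h.
  by case/existsP=> q /andP[qA /eqP]; exists q.
have /hasP[k kc kI] : has (gso_sat I v) (Defs.head c).
  apply: cP; rewrite all_body; apply/andP; split.
    by apply: sub_all plain => t; rewrite (plain_bodyP _ (gso_sat I v)).
  apply/allP => k /(inA false)[q qA <-].
  rewrite -(guard_interpP (matchA _ qA)).
  by move/allP: bodies; apply; rewrite mem_filter mem_enum.
have [q qA qk] := inA true k kc.
rewrite has_map; apply/hasP; exists (true, q).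
  by rewrite mem_filter mem_enum.
change (mso_sat guard_interp v' (guard_atom (true, q))).
by rewrite (guard_interpP (matchA _ qA)) qk.
Qed.

End Interp.

End Extension.

(** * From sets of facts back to relations *)

Section Coded.
Variable J : guard_var -> {set (adom D + D)%type}.

Definition coded (p : guard_var) (w : (arity (guard_sym p)).-tuple (adom D)) :=
  [exists B : D, (val B == fact_of w) && (inr B \in J p)].

Definition coded_interp (Z : X) : {set (ar Z).-tuple (adom D)} :=
  [set t | [exists p : guard_pos Z,
     [exists w : (arity (val (tag p))).-tuple (adom D),
        (t == map_tuple (tnth w) (tagged p)) &&
        @coded (existT _ Z p) w]]].

Lemma coded_interpP (v : V -> adom D) (k : gso_atom ar V) :
  reflect (exists q : guarded_atom, unguard q = k /\
             exists w, matches v q w /\ @coded (tag q) w)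
          (gso_sat coded_interp v k).
Proof.
apply: (iffP idP) => [| [q [<- [w [/andP[wD /eqP wE] wJ]]]]].
  case: k => Z x; rewrite /gso_sat inE /=.
  case/existsP => p /existsP[w /andP[/eqP wE wJ]].
  exists (existT _ (existT _ Z p) x); split=> //; exists w; split=> //.
  rewrite /matches /= wE eqxx andbT.
  by case/existsP: wJ => B /andP[/eqP<- _]; apply: valP.
rewrite /gso_sat inE /= wE.
case: q w wD wE wJ => [[Z p] x] /= w _ _ wJ.
by apply/existsP; exists p; apply/existsP; exists w; rewrite eqxx.
Qed.

Lemma guard_atomP (v : F + (U + fresh) -> adom D) e :
  mso_sat J v (guard_atom e) = coded (fresh_tuple v e).
Proof. by rewrite /= guard_factE. Qed.

(* All the entries of T occur together in one fact of D. *)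
Definition covered (T : seq (adom D)) :=
  exists (R : guard_symbol) (w : (arity (val R)).-tuple (adom D)),
    fact_of w \in D /\ {subset T <= w}.

(** Sending each coordinate to a position of the fact that carries its value gives the index map of
    a code. *)
Lemma covered_matches (v : V -> adom D) (k : gso_atom ar V) :
  covered (map v (tagged k)) ->
  exists2 q : guarded_atom, unguard q = k & exists w, matches v q w.
Proof.
case: k => Z x [R [w [wD xw]]] /=.
have nP j : {i | tnth w i = v (tnth x j)}.
  have /tnthP/sig_eqW[i ->] : v (tnth x j) \in w by apply/xw/map_f/mem_tnth.
  by exists i.
pose f := [tuple sval (nP j) | j < ar Z].
exists (existT (fun p : guard_var => (ar (tag p)).-tuple V)
          (existT guard_pos Z (existT _ R f)) x) => //.
exists w; rewrite /matches wD /=; apply/eqP/eq_from_tnth => j.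
by rewrite !tnth_map tnth_ord_tuple; case: (nP j).
Qed.

(** A second-order atom has a coding fact, a relational atom is itself a fact, and an equality
    concerns one active element, which occurs in some fact. *)
Lemma body_covered (v : V -> adom D) (t : atom S V (gso_atom ar V)) :
  atom_sat (gso_sat coded_interp v) v t -> covered (map v (atom_vars t)).
Proof.
case: t => [k /coded_interpP[q [<- [w [/andP[wD /eqP wE] _]]]] | [R x] xD | x y].
- exists (tag (tagged (tag q))), w; split=> // d /= dx.
  have: d \in map_tuple v (tagged q) by [].
  by rewrite wE => /mapP[i _ ->]; apply: mem_tnth.
- have gR : (0 < #|{: V}|) || (arity R == 0).
    case: (posnP (arity R)) => [_|R0]; first by rewrite orbT.
    by apply/orP; left; apply/card_gt0P; exists (tnth x (Ordinal R0)).
  exists (Sub R gR), (map_tuple v x); split=> //.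
  suff -> : fact_of (map_tuple v x) = fact_map (val \o v) (existT _ R x) by [].
  by congr existT; apply: val_inj; rewrite /= -map_comp.
move=> /= /eqP <-; have [B BD xB] := adom_in_fact (v x).
have gR : (0 < #|{: V}|) || (arity (tag B) == 0).
  by apply/orP; left; apply/card_gt0P; exists x.
have [w wE] := lift_tuple (fact_sub_adom BD).
exists (Sub (tag B) gR), w; split; first by rewrite /fact_of /= wE; case: (B) BD.
by move=> d; rewrite !inE orbb => /eqP->; move: xB; rewrite -wE /= (mem_map val_inj).
Qed.

Lemma covered_sub T T' : {subset T <= T'} -> covered T' -> covered T.
Proof.
by move=> sTT' [R [w [wD sub]]]; exists R, w; split=> // d /sTT' /sub.
Qed.

(** A body choice needs a fact already marked by [J]; a head choice only needs a fact on which the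
    mark could stand. *)
Definition witness (v : V -> adom D) (e : guard_choice)
    (w : (arity (guard_sym (tag e.2))).-tuple (adom D)) :=
  matches v e.2 w && (e.1 || @coded (tag e.2) w).

Definition choice_at (v : V -> adom D) (c : clause S V (gso_atom ar V)) :
    {set guard_choice} :=
  [set e : guard_choice | (unguard e.2 \in so_atoms c e.1) &&
    [exists w, @witness v e w]].

Lemma choice_atP v c :
  guarded c -> all (atom_sat (gso_sat coded_interp v) v) (body c) ->
  choice_of c (choice_at v c).
Proof.
move=> /allP cg bP; apply/forallP => h; apply/forallP => k; apply/eqP.
apply/idP/existsP => [kc | [q]]; last first.
  by rewrite inE /= => /andP[/andP[qc _] /eqP <-].
suff [q qk [w wP]] : exists2 q, unguard q = k & exists w, @witness v (h, q) w.
  exists q; rewrite inE qk eqxx kc andbT /=.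
  by apply/existsP; exists w.
(* A head atom is covered through its guard, a true body atom; a body atom is true, hence already
   coded. *)
case: h kc => kc.
  have [t [tk tP]] : exists t, all (mem (atom_vars t)) (tagged k) /\
      atom_sat (gso_sat coded_interp v) v t.
    elim: (body c) (cg k kc) bP => //= t ts IHts /orP[tk | /IHts tsP].
      by case/andP=> tP _; exists t.
    by case/andP=> _ /tsP.
  have /covered_matches[q qk [w wP]] : covered (map v (tagged k)).
    apply: covered_sub (body_covered tP) => d /mapP[x xk ->].
    by apply: map_f; move/allP: tk; apply.
  by exists q => //; exists w; rewrite /witness wP.
move: bP; rewrite all_body => /andP[_ /allP/(_ k kc)].
case/coded_interpP=> q [qk [w [wP wJ]]].
by exists q => //; exists w; rewrite /witness wP wJ orbT.
Qed.

End Coded.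

(** A fallback for choices without witness. A fresh variable is a position in a symbol of nonzero
    arity, so [guard_symbol] makes [V] inhabited. *)
Lemma fresh_default (s : fresh) : V.
Proof.
case: s => e i; case: (posnP #|{: V}|) => [V0 | /card_gt0P/sigW[x _]].
  suff R0 : arity (guard_sym (tag e.2)) = 0 by move: i; rewrite R0 => -[].
  by have /orP[|/eqP//] := valP (tag (tagged (tag e.2))); rewrite V0.
exact: x.
Qed.

Definition fresh_value J (a : F -> adom D) (b : U -> adom D) (s : fresh) :
    adom D :=
  if [pick w | @witness J (assign a b) (tag s) w] is Some w
  then tnth w (tagged s) else assign a b (fresh_default s).

(** The translated clause for [choice_at] is used, with the fresh variables naming witnesses. Its
    body then holds, and the marked head fact it yields decodes to a head atom of [c]. *)
Lemma guard_clause_complete J a b c :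
  guarded c ->
  (forall A b', choice_of c A ->
     clause_sat (mso_sat J (assign a b')) (assign a b') (guard_clause c A)) ->
  clause_sat (gso_sat (coded_interp J) (assign a b)) (assign a b) c.
Proof.
move=> cg cP; apply/clause_sat_impl => bP.
set v := assign a b in bP *.
pose b' := assign b (fresh_value J a b); pose v' := assign a b'.
have v'E x : v' (new_var x) = v x by case: x.
have wP e : e \in choice_at J v c -> @witness J v e (fresh_tuple v' e).
  rewrite inE => /andP[_ /existsP[w0 w0P]].
  (* All fresh variables of one choice read off the same picked tuple, so together they spell out a
     single witness. *)
  have [w wP wE] : exists2 w, @witness J v e w &
      forall i, v' (fresh_var (e := e) i) = tnth w i.
    rewrite /v' /= /fresh_value /=; case: pickP => [w wP | /(_ w0)].
      by exists w.
    by rewrite -/v w0P.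
  suff -> : fresh_tuple v' e = w by [].
  by apply: eq_from_tnth => i; rewrite tnth_map tnth_ord_tuple wE.
have /clause_sat_impl := cP _ b' (choice_atP cg bP).
rewrite /= !all_cat !all_flatten_map all_map has_map.
have body' : [&& all (fun t => all (atom_sat (mso_sat J v') v') (plain_body t))
                   (body c),
               all (fun e => all (atom_sat (mso_sat J v') v') (guard_body e))
                   (enum (choice_at J v c)) &
               all (fun e => mso_sat J v' (guard_atom e))
                   [seq e <- enum (choice_at J v c) | ~~ e.1]].
  apply/and3P; split.
  - apply: sub_all bP => t.
    by rewrite (plain_bodyP v'E _ (gso_sat (coded_interp J) v)); case: t.
  - apply/allP => e; rewrite mem_enum => /wP/andP[+ _].
    by rewrite (guard_bodyP v'E).
  - apply/allP => e; rewrite mem_filter mem_enum => /andP[e1 /wP/andP[_]].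
    by rewrite guard_atomP (negPf e1).
move=> /(_ body')/hasP[e]; rewrite mem_filter mem_enum => /andP[e1 eA].
change (mso_sat J v' (guard_atom e) -> has (gso_sat (coded_interp J) v) (Defs.head c)).
rewrite guard_atomP => eJ.
apply/hasP; exists (unguard e.2).
  by move: eA; rewrite inE e1 => /andP[].
apply/coded_interpP; exists e.2; split=> //; exists (fresh_tuple v' e).
by have /andP[-> _] := wP _ eA.
Qed.

End FromGmsnp.

Lemma gmsnp_mmsnp2 (S : schema) (F : finType) (phi : gmsnp S F) :
  exists psi : mmsnp2 S F,
    forall (C : choiceType) (D : instance S C) (a : F -> adom D),
      gmsnp_sat phi a <-> mmsnp2_sat psi a.
Proof.
exists (Mmsnp2 (guard_clauses_guarded (g_clauses phi))) => C D a.
split=> -[D0 | [I IP]]; [by left | right | by left | right].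
  exists (guard_interp I) => b' /=; rewrite all_flatten_map.
  (* The original clauses are used at the restriction of [b'] to the original variables. *)
  apply: sub_all (IP (fun x => b' (inl x))) => c cP.
  rewrite all_map; apply/allP => A; rewrite mem_filter => /andP[cA _] /=.
  by apply: guard_clause_sound cA cP => -[].
exists (coded_interp I) => b; move: (g_guarded phi) IP => /=.
elim: (g_clauses phi) => //= c cs IHcs /andP[cg csg] csP.
apply/andP; split; last first.
  by apply: IHcs csg _ => b'; have := csP b'; rewrite all_cat => /andP[].
apply: guard_clause_complete cg _ => A b' cA.
have := csP b'; rewrite all_cat => /andP[+ _]; rewrite all_map => /allP.
by apply; rewrite mem_filter cA mem_enum.
Qed.

Theorem proposition3 (S : schema) (F : finType) :
  (forall phi : gmsnp S F, exists psi : mmsnp2 S F,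
     forall (C : choiceType) (D : instance S C) (a : F -> adom D),
       gmsnp_sat phi a <-> mmsnp2_sat psi a)
  /\
  (forall psi : mmsnp2 S F, exists phi : gmsnp S F,
     forall (C : choiceType) (D : instance S C) (a : F -> adom D),
       mmsnp2_sat psi a <-> gmsnp_sat phi a).
Proof. split; [exact: gmsnp_mmsnp2 | exact: mmsnp2_gmsnp]. Qed.
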